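(* The closed-loop SMP system $x_{t+1}=(A_t(\theta_t)-B_t(\theta_t)K)x_t$ is exponentially robustly mean-square stable with rate $\beta\in(0,1)$ if and only if its expanded system $\tilde x_{t+1}=\mathcal{C}(F(\tilde\theta_t,K))\tilde x_t$ is exponentially robustly stable with rate $\tilde\beta\in(0,1)$ satisfying $\tilde\beta=\beta^2$.
   Context: Let $n,m,d_\theta$ be positive integers and $\mathbb{S}_\theta\subset\mathbb{R}^{d_\theta}$. Consider $x_{t+1}=A_t(\theta_t)x_t+B_t(\theta_t)u_t$, $t=0,1,2,\dots$, with $x_t\in\mathbb{R}^n$, $u_t\in\mathbb{R}^m$, deterministic $x_0$, uncertain $\theta_t\in\mathbb{S}_\theta$. The random vector $v_t(\theta_t):=\mathrm{vec}([A_t(\theta_t),B_t(\theta_t)])\in\mathbb{R}^{n(n+m)}$ has a Lebesgue-measurable conditional density $p(v_t\mid\theta_t)$, and for every $s\ge1$ the conditional density of $(v_0,\dots,v_s)$ given $(\theta_0,\theta_1,\dots)$ is $\prod_{t=0}^sp(v_t\mid\theta_t)$; $\mathrm{E}[\cdot|_{\theta_\bullet}]$ is conditional expectation given $(\theta_0,\theta_1,\dots)$. $\mathrm{vec}$ stacks columns; $\mathrm{vech}(X)$ stacks columnwise the entries on and below the diagonal. $\mathbb{P}_N:=\{\varphi\in\mathbb{R}^N:\varphi_k\ge0,\sum_k\varphi_k=1\}$. The system is SMP: there exist $N$, symmetric $M^{(1)},\dots,M^{(N)}\in\mathbb{R}^{n(n+m)\times n(n+m)}$, and $\phi:\mathbb{S}_\theta\to\mathbb{P}_N$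 with $\mathrm{E}[v_tv_t^\top|_{\theta_\bullet}]=\sum_k[\phi(\theta_t)]_kM^{(k)}$ for all $t$ and all sequences in $\mathbb{S}_\theta$. It is TI if $\theta_t=\theta$ is constant in $t$ (then parameter sequences below are constant), TV otherwise. For $K\in\mathbb{R}^{m\times n}$ the closed loop is $x_{t+1}=(A_t(\theta_t)-B_t(\theta_t)K)x_t$. It is exponentially robustly mean-square stable (with rate $\beta$) if there exist $\alpha\in(0,\infty)$, $\beta\in(0,1)$ with $\sqrt{\mathrm{E}[\|x_t\|^2|_{\theta_\bullet}]}\le\alpha\|x_0\|\beta^t$ for all $x_0\in\mathbb{R}^n$, all $\theta_0,\theta_1,\dots\in\mathbb{S}_\theta$, and all $t$. Expanded system: $\tilde n=n(n+1)/2$; $E_e\in\mathbb{R}^{\tilde n\times n^2}$ with $E_e\mathrm{vec}(X)=\mathrm{vech}(X)$ for all $X$; $D\in\mathbb{R}^{n^2\times\tilde n}$ with $D\mathrm{vech}(Y)=\mathrm{vec}(Y)$ for symmetric $Y$; $\mathcal{C}(Y):=E_eYD$. With blocks $M^{(k)}_{i,j}\in\mathbb{R}^{n\times n}$ ($i,j\le n+m$) of $M^{(k)}$: column $n(j-1)+i$ of $F^{(k)}_{aa}$ is $\mathrm{vec}(M^{(k)}_{i,j})$; column $m(j-1)+i'$ of $F^{(k)}_{ab}$ is $\mathrm{vec}(M^{(k)}_{n+i',j})$; column $n(j'-1)+i$ of $F^{(k)}_{ba}$ is $\mathrm{vec}(M^{(k)}_{i,n+j'})$; column $m(j'-1)+i'$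 of $F^{(k)}_{bb}$ is $\mathrm{vec}(M^{(k)}_{n+i',n+j'})$ ($i,j\le n$, $i',j'\le m$). $F^{(k)}(K):=F^{(k)}_{aa}-F^{(k)}_{ab}(I_n\otimes K)-F^{(k)}_{ba}(K\otimes I_n)+F^{(k)}_{bb}(K\otimes K)$, $F(\tilde\theta,K):=\sum_k[\tilde\theta]_kF^{(k)}(K)$. Expanded system: $\tilde x_{t+1}=\mathcal{C}(F(\tilde\theta_t,K))\tilde x_t$, $\tilde x_t\in\mathbb{R}^{\tilde n}$, $\tilde\theta_t\in\tilde{\mathbb{S}}:=\{\phi(\theta):\theta\in\mathbb{S}_\theta\}$; TI/TV as the SMP system. It is exponentially robustly stable (with rate $\tilde\beta$) if there exist $\tilde\alpha\in(0,\infty)$, $\tilde\beta\in(0,1)$ with $\|\tilde x_t\|\le\tilde\alpha\|\tilde x_0\|\tilde\beta^t$ for all $\tilde x_0$, all $\tilde\theta_0,\tilde\theta_1,\dots\in\tilde{\mathbb{S}}$, and all $t$. *)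

(* Defs.v *)
From HB Require Import structures.
From mathcomp Require Import all_boot all_order all_algebra.
From mathcomp Require Import all_classical all_reals all_analysis.
Set Implicit Arguments. Unset Strict Implicit. Unset Printing Implicit Defensive.
Import Order.TTheory GRing.Theory Num.Theory.
Local Open Scope ring_scope.

Section Defs.
Variable R : realType.

Definition mget p q (M : 'M[R]_(p, q)) (r c : nat) : R :=
  match (insub r : option 'I_p), (insub c : option 'I_q) with
  | Some i, Some j => M i j
  | _, _ => 0
  end.

Definition vec p q (X : 'M[R]_(p, q)) : 'cV[R]_(p * q) :=
  \col_k nth 0 (flatten [seq [seq mget X r c | r <- iota 0 p] | c <- iota 0 q]) k.

Definition ntri (n : nat) : nat := (n * n.+1) %/ 2.

Definition vech n (X : 'M[R]_n) : 'cV[R]_(ntri n) :=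
  \col_k nth 0 (flatten [seq [seq mget X r c | r <- iota c (n - c)] | c <- iota 0 n]) k.

Definition kron m1 n1 m2 n2 (A : 'M[R]_(m1, n1)) (B : 'M[R]_(m2, n2))
  : 'M[R]_(m1 * m2, n1 * n2) :=
  \matrix_(i, j) (mget A (i %/ m2) (j %/ n2) * mget B (i %% m2) (j %% n2)).

Definition blk n p (M : 'M[R]_p) (i j : nat) : 'M[R]_n :=
  \matrix_(r < n, c < n) mget M (n * i + r) (n * j + c).

Definition F_aa n m (M : 'M[R]_(n * (n + m))) : 'M[R]_(n * n, n * n) :=
  \matrix_(a, b) vec (blk n M (b %% n) (b %/ n)) a 0.
Definition F_ab n m (M : 'M[R]_(n * (n + m))) : 'M[R]_(n * n, n * m) :=
  \matrix_(a, b) vec (blk n M (n + b %% m) (b %/ m)) a 0.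
Definition F_ba n m (M : 'M[R]_(n * (n + m))) : 'M[R]_(n * n, m * n) :=
  \matrix_(a, b) vec (blk n M (b %% n) (n + b %/ n)) a 0.
Definition F_bb n m (M : 'M[R]_(n * (n + m))) : 'M[R]_(n * n, m * m) :=
  \matrix_(a, b) vec (blk n M (n + b %% m) (n + b %/ m)) a 0.

Definition FK n m (M : 'M[R]_(n * (n + m))) (K : 'M[R]_(m, n)) : 'M[R]_(n * n) :=
  F_aa M - F_ab M *m kron (1%:M : 'M[R]_n) K - F_ba M *m kron K (1%:M : 'M[R]_n)
  + F_bb M *m kron K K.

Definition Ftheta n m N (Ms : 'I_N -> 'M[R]_(n * (n + m))) (th : 'cV[R]_N)
  (K : 'M[R]_(m, n)) : 'M[R]_(n * n) :=
  \sum_(k < N) th k 0 *: FK (Ms k) K.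

Definition Ccal n (Ee : 'M[R]_(ntri n, n * n)) (D : 'M[R]_(n * n, ntri n))
  (Y : 'M[R]_(n * n)) : 'M[R]_(ntri n) := Ee *m Y *m D.

Definition enorm k (x : 'cV[R]_k) : R := Num.sqrt (\sum_(i < k) x i 0 ^+ 2).

(* [A, B] recovered from v = vec([A, B]) *)
Definition Amat n m (v : 'cV[R]_(n * (n + m))) : 'M[R]_n :=
  \matrix_(r < n, c < n) mget v (c * n + r) 0.
Definition Bmat n m (v : 'cV[R]_(n * (n + m))) : 'M[R]_(n, m) :=
  \matrix_(r < n, c < m) mget v ((n + c) * n + r) 0.

Definition Acl n m (v : 'cV[R]_(n * (n + m))) (K : 'M[R]_(m, n)) : 'M[R]_n :=
  Amat v - Bmat v *m K.

Definition admissible (T : Type) (ti : bool) (S : set T) (th : nat -> T) : Prop :=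
  (forall t, S (th t)) /\ (ti -> forall t, th t = th 0%N).

(* E[ ||x_t||^2 | theta_. ] for the closed loop started at x (time 0):
   since (v_0, ..., v_{t-1}) has conditional law prod_s mu(theta_s), this
   conditional expectation is the iterated integral below. *)
Fixpoint msq (dth n m : nat) (d : measure_display) (V : measurableType d)
  (vv : V -> 'cV[R]_(n * (n + m))) (mu : 'cV[R]_dth -> probability V R)
  (K : 'M[R]_(m, n)) (t : nat) (th : nat -> 'cV[R]_dth) (x : 'cV[R]_n)
  : \bar R :=
  match t with
  | 0%N => ((enorm x) ^+ 2)%:E
  | t'.+1 => (\int[mu (th 0%N)]_w
                msq vv mu K t' (fun s => th s.+1) (Acl (vv w) K *m x))%E
  end.

Definition ERMSS (dth n m : nat) (d : measure_display) (V : measurableType d)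
  (vv : V -> 'cV[R]_(n * (n + m))) (mu : 'cV[R]_dth -> probability V R)
  (K : 'M[R]_(m, n)) (ti : bool) (Sth : set 'cV[R]_dth) (beta : R) : Prop :=
  0 < beta < 1 /\
  exists alpha : R, 0 < alpha /\
    forall (x0 : 'cV[R]_n) (th : nat -> 'cV[R]_dth), admissible ti Sth th ->
    forall t : nat,
      (msq vv mu K t th x0 <= ((alpha * enorm x0 * beta ^+ t) ^+ 2)%:E)%E.

Fixpoint xtil n m N (Ms : 'I_N -> 'M[R]_(n * (n + m)))
  (Ee : 'M[R]_(ntri n, n * n)) (D : 'M[R]_(n * n, ntri n)) (K : 'M[R]_(m, n))
  (tht : nat -> 'cV[R]_N) (x0 : 'cV[R]_(ntri n)) (t : nat) : 'cV[R]_(ntri n) :=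
  match t with
  | 0%N => x0
  | t'.+1 => Ccal Ee D (Ftheta Ms (tht t') K) *m xtil Ms Ee D K tht x0 t'
  end.

Definition ERS n m N (Ms : 'I_N -> 'M[R]_(n * (n + m)))
  (Ee : 'M[R]_(ntri n, n * n)) (D : 'M[R]_(n * n, ntri n)) (K : 'M[R]_(m, n))
  (ti : bool) (Stil : set 'cV[R]_N) (betat : R) : Prop :=
  0 < betat < 1 /\
  exists alphat : R, 0 < alphat /\
    forall (x0 : 'cV[R]_(ntri n)) (tht : nat -> 'cV[R]_N), admissible ti Stil tht ->
    forall t : nat, enorm (xtil Ms Ee D K tht x0 t) <= alphat * enorm x0 * betat ^+ t.

End Defs.

(* Main.v *)
(* Conditionally on the parameters, the second moment X_t = E[x_t x_t^T] evolves by
   X |-> E[(A - B K) X (A - B K)^T], which is linear in E[v v^T] and whose matrix in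
   vec coordinates is F(theta, K). Hence vech X_t is a trajectory of the expanded
   system, and E|x_t|^2 is the trace of X_t. Stability of the expanded system
   therefore bounds the trace. Conversely, by polarization every symmetric initial
   matrix is a combination of rank-one ones, along which X_t stays positive
   semidefinite, so that all its entries are bounded by its trace. *)
Require Import Defs.
From HB Require Import structures.
From mathcomp Require Import all_boot all_order all_algebra.
From mathcomp Require Import all_classical all_reals all_analysis.
From mathcomp Require Import ring lra zify.
Set Implicit Arguments.
Unset Strict Implicit.
Unset Printing Implicit Defensive.
Import Order.TTheory GRing.Theory Num.Theory.
Local Open Scope ring_scope.
Local Open Scope classical_set_scope.

(** * Column-stacking in terms of quotient and remainder *)

Section VecIndexing.
Variable R : realType.
Implicit Types p q n m : nat.

Lemma mgetE p q (M : 'M[R]_(p, q)) (i : 'I_p) (j : 'I_q) : mget M i j = M i j.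
Proof. by rewrite /mget !valK. Qed.

Lemma mget_linear p q r c : scalar (fun M : 'M[R]_(p, q) => mget M r c).
Proof.
move=> a A B; rewrite /mget; case: insub => [i|]; last by rewrite mulr0 addr0.
by case: insub => [j|]; rewrite ?mulr0 ?addr0 // !mxE.
Qed.

Lemma mget_tr p q (M : 'M[R]_(p, q)) r c : mget M^T r c = mget M c r.
Proof. by rewrite /mget; case: insub; case: insub => // i j; rewrite mxE. Qed.

Lemma nth_flatten_grid (f : nat -> nat -> R) p q k (kpq : (k < p * q)%N) :
  nth 0 (flatten [seq [seq f r c | r <- iota 0 p] | c <- iota 0 q]) k
  = f (k %% p)%N (k %/ p)%N.
Proof.
(* With the first column [c0] general, the induction can peel off one column, which shifts [k] by
   [p]. *)
suff gen c0 : nth 0 (flatten [seq [seq f r c | r <- iota 0 p] | c <- iota c0 q]) k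
    = f (k %% p)%N (c0 + k %/ p)%N by rewrite gen add0n.
elim: q k c0 kpq => [|q IHq] k c0; first by rewrite muln0.
rewrite mulnS /= nth_cat size_map size_iota => kpq.
case: ltnP => kp.
  by rewrite (nth_map 0%N) ?size_iota// nth_iota// modn_small// divn_small// addn0.
rewrite IHq; last by rewrite ltn_subLR// (leq_ltn_trans _ kpq).
have p0 : (0 < p)%N by case: (p) kpq kp => //; rewrite mul0n.
rewrite -[in RHS](subnKC kp) modnDl divnDl ?dvdnn// divnn p0.
by rewrite add1n addnS addSn.
Qed.

Lemma vecE p q (X : 'M[R]_(p, q)) (k : 'I_(p * q)) :
  vec X k 0 = mget X (k %% p) (k %/ p).
Proof. by rewrite mxE nth_flatten_grid. Qed.

Lemma vec_linear p q : linear (@vec R p q).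
Proof. by move=> a A B; apply/colP => k; rewrite !(vecE, mxE) mget_linear. Qed.

(** Turns a matrix-vector product indexed by stacked columns into a double sum over matrix
    entries. *)
Lemma sum_divmod p q (f : nat -> nat -> R) :
  \sum_(k < q * p) f (k %% p)%N (k %/ p)%N = \sum_(j < q) \sum_(i < p) f i j.
Proof.
rewrite -(big_mkord xpredT (fun k => f (k %% p)%N (k %/ p)%N)) big_nat_mul big_mkord.
apply: eq_bigr => j _; rewrite mulSn -{1}[(j * p)%N]add0n big_addn addnK.
rewrite big_mkord; apply: eq_bigr => i _.
have p0 : (0 < p)%N by case: (p) i => // -[].
by rewrite addnC modnMDl modn_small// divnMDl// divn_small// addn0.
Qed.

End VecIndexing.

HB.instance Definition _ (R : realType) p q :=
  GRing.isLinear.Build R 'M[R]_(p, q) 'cV[R]_(p * q) _ (@vec R p q) (@vec_linear R p q).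

(** * The matrix [F] as the second-moment map in vec coordinates *)

Section SecondMoment.
Variable R : realType.

Lemma sum_vec_blocks n p q (f : nat -> nat -> 'M[R]_n) (Y : 'M[R]_(p, q)) a :
  \sum_(b < q * p) vec (f (b %% p)%N (b %/ p)%N) a 0 * mget Y (b %% p) (b %/ p)
  = vec (\sum_(j < q) \sum_(i < p) Y i j *: f i j) a 0.
Proof.
rewrite (sum_divmod _ _ (fun i j => vec (f i j) a 0 * mget Y i j)).
rewrite linear_sum summxE; apply: eq_bigr => j _.
rewrite linear_sum summxE; apply: eq_bigr => i _.
by rewrite linearZ [RHS]mxE mgetE mulrC.
Qed.

(** This is the identity $(B \otimes A)\,\mathrm{vec}(X) = \mathrm{vec}(A X B^\top)$. It is put
    entrywise because the two sides have the dimensions [m1 * m2] and [m2 * m1], which are different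
    types. *)
Lemma kron_vec n m1 m2 (B : 'M[R]_(m1, n)) (A : 'M[R]_(m2, n)) (X : 'M[R]_n) i :
  (kron B A *m vec X) i 0 = mget (A *m X *m B^T) (i %% m2) (i %/ m2).
Proof.
have m2_gt0 : (0 < m2)%N by case: (m2) i => // -[i]; rewrite muln0.
have im2 : (i %% m2 < m2)%N by rewrite ltn_pmod.
have im1 : (i %/ m2 < m1)%N by rewrite ltn_divLR.
rewrite mxE; under eq_bigr do rewrite mxE vecE.
rewrite (sum_divmod _ _ (fun r c =>
  mget B (i %/ m2) c * mget A (i %% m2) r * mget X r c)).
rewrite (mgetE (A *m X *m B^T) (Ordinal im2) (Ordinal im1)) mxE.
apply: eq_bigr => c _; rewrite mxE mulr_suml; apply: eq_bigr => r _.
rewrite mxE -!mgetE /=; ring.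
Qed.

(** Sends $x$ to the stacked pair $(x, u)$ with $u = -Kx$, so that $A - BK = [A, B]$ times this
    matrix. *)
Definition lift_gain n m (K : 'M[R]_(m, n)) : 'M[R]_(n + m, n) := col_mx 1%:M (- K).

(* For [M = E[v v^T]] this is [E[(A - B K) X (A - B K)^T]]. *)
Definition cov_step n m (M : 'M[R]_(n * (n + m))) (K : 'M[R]_(m, n)) (X : 'M[R]_n)
  : 'M[R]_n :=
  \sum_(q < n + m) \sum_(p < n + m)
    (lift_gain K *m X *m (lift_gain K)^T) p q *: blk n M p q.

Lemma lift_gainE n m (K : 'M[R]_(m, n)) (X : 'M[R]_n) :
  lift_gain K *m X *m (lift_gain K)^T
  = block_mx X (- (X *m K^T)) (- (K *m X)) (K *m X *m K^T).
Proof.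
rewrite /lift_gain mul_col_mx tr_col_mx mul_col_row trmx1 linearN /= mul1mx.
by rewrite !mulmx1 !mulmxN !mulNmx opprK.
Qed.

(** The four blocks of [lift_gain K *m X *m (lift_gain K)^T] are the coefficient matrices paired
    with [F_aa], [F_ab], [F_ba] and [F_bb]; each Kronecker factor produces one block by [kron_vec],
    and the signs agree. *)
Lemma FK_vec n m (M : 'M[R]_(n * (n + m))) (K : 'M[R]_(m, n)) (X : 'M[R]_n) :
  FK M K *m vec X = vec (cov_step M K X).
Proof.
rewrite /FK !(mulmxDl, mulNmx) -!mulmxA; apply/colP => a.
have aa : (F_aa M *m vec X) a 0
    = vec (\sum_(j < n) \sum_(i < n) X i j *: blk n M i j) a 0.
  rewrite mxE -sum_vec_blocks; apply: eq_bigr => b _.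
  by rewrite mxE [vec X b 0]vecE.
have ab : (F_ab M *m (kron (1%:M : 'M[R]_n) K *m vec X)) a 0
    = vec (\sum_(j < n) \sum_(i < m) (K *m X) i j *: blk n M (n + i) j) a 0.
  rewrite mxE -(sum_vec_blocks (fun i j => blk n M (n + i) j)).
  by apply: eq_bigr => b _; rewrite mxE kron_vec trmx1 mulmx1.
have ba : (F_ba M *m (kron K (1%:M : 'M[R]_n) *m vec X)) a 0
    = vec (\sum_(j < m) \sum_(i < n) (X *m K^T) i j *: blk n M i (n + j)) a 0.
  rewrite mxE -(sum_vec_blocks (fun i j => blk n M i (n + j))).
  by apply: eq_bigr => b _; rewrite mxE kron_vec mul1mx.
have bb : (F_bb M *m (kron K K *m vec X)) a 0
    = vec (\sum_(j < m) \sum_(i < m) (K *m X *m K^T) i j *: blk n M (n + i) (n + j)) a 0.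
  rewrite mxE -(sum_vec_blocks (fun i j => blk n M (n + i) (n + j))).
  by apply: eq_bigr => b _; rewrite mxE kron_vec.
rewrite mxE [(_ - F_ba M *m _) a 0]mxE [(F_aa M *m _ - _) a 0]mxE.
rewrite [(- (F_ab M *m _)) a 0]mxE [(- (F_ba M *m _)) a 0]mxE aa ab ba bb.
have vecD (Y Z : 'M[R]_n) : vec Y a 0 + vec Z a 0 = vec (Y + Z) a 0.
  by rewrite linearD [RHS]mxE.
have vecN (Y : 'M[R]_n) : - vec Y a 0 = vec (- Y) a 0 by rewrite linearN [RHS]mxE.
rewrite !(vecN, vecD); congr (vec _ a 0).
(* Both index ranges [n + m] are split, column index first, and the four partial sums are matched
   block by block. *)
rewrite /cov_step lift_gainE big_split_ord /= -addrA; congr (_ + _); last first.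
  rewrite -sumrN -big_split; apply: eq_bigr => j _ /=.
  rewrite big_split_ord /= -sumrN; congr (_ + _); apply: eq_bigr => i _.
    by rewrite block_mxEur [in RHS]mxE scaleNr.
  by rewrite block_mxEdr.
rewrite -sumrN -big_split; apply: eq_bigr => j _ /=.
rewrite big_split_ord /= -sumrN; congr (_ + _); apply: eq_bigr => i _.
  by rewrite block_mxEul.
by rewrite block_mxEdl [in RHS]mxE scaleNr.
Qed.

Lemma blk_linear n p i j : linear (fun M : 'M[R]_p => blk n M i j).
Proof. by move=> a A B; apply/matrixP => r c; rewrite !mxE mget_linear. Qed.

Lemma blk_tr n p (M : 'M[R]_p) i j : (blk n M i j)^T = blk n M^T j i.
Proof. by apply/matrixP => r c; rewrite !mxE mget_tr. Qed.

Lemma cov_step_linearl n m (K : 'M[R]_(m, n)) X :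
  linear (fun M : 'M[R]_(n * (n + m)) => cov_step M K X).
Proof.
move=> a A B; rewrite /cov_step scaler_sumr -big_split; apply: eq_bigr => q _ /=.
rewrite scaler_sumr -big_split; apply: eq_bigr => p _ /=.
by rewrite blk_linear scalerDr !scalerA mulrC.
Qed.

Lemma cov_step_linear n m (M : 'M[R]_(n * (n + m))) (K : 'M[R]_(m, n)) :
  linear (cov_step M K).
Proof.
move=> a A B; rewrite /cov_step scaler_sumr -big_split; apply: eq_bigr => q _ /=.
rewrite scaler_sumr -big_split; apply: eq_bigr => p _ /=.
by rewrite mulmxDr mulmxDl -scalemxAr -scalemxAl !mxE scalerDl scalerA.
Qed.

Lemma cov_step_tr n m (M : 'M[R]_(n * (n + m))) (K : 'M[R]_(m, n)) X :
  (cov_step M K X)^T = cov_step M^T K X^T.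
Proof.
rewrite /cov_step exchange_big linear_sum; apply: eq_bigr => q _ /=.
rewrite linear_sum; apply: eq_bigr => p _; rewrite linearZ /= blk_tr; congr (_ *: _).
have -> : lift_gain K *m X^T *m (lift_gain K)^T = (lift_gain K *m X *m (lift_gain K)^T)^T.
  by rewrite !trmx_mul trmxK mulmxA.
by rewrite [RHS]mxE.
Qed.

(** Let $V = [A, B]$ be the matrix whose stacked columns form $v$. Block $(p, q)$ of $v v^\top$ is
    the product of column $p$ of $V$ with the transpose of column $q$, so the weighted sum of blocks
    is $V G V^\top$. *)
Lemma cov_step_rank1 n m (v : 'cV[R]_(n * (n + m))) (K : 'M[R]_(m, n)) X :
  cov_step (v *m v^T) K X = Acl v K *m X *m (Acl v K)^T.
Proof.
have idxP (p : 'I_(n + m)) (r : 'I_n) : (n * p + r < n * (n + m))%N.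
  by rewrite (leq_trans (n := n * p + n)%N) ?ltn_add2l// -mulnSr leq_mul2l ltn_ord orbT.
pose V : 'M[R]_(n, n + m) := \matrix_(r, p) v (Ordinal (idxP p r)) 0.
have AclE : Acl v K = V *m lift_gain K.
  have VA : lsubmx V = Amat v.
    by apply/matrixP => r c; rewrite !mxE -mgetE /= [(n * c)%N]mulnC.
  have VB : rsubmx V = Bmat v.
    by apply/matrixP => r c; rewrite !mxE -mgetE /= [(n * (n + c))%N]mulnC.
  by rewrite /lift_gain -[V]hsubmxK mul_row_col mulmx1 mulmxN VA VB.
have -> : Acl v K *m X *m (Acl v K)^T = V *m (lift_gain K *m X *m (lift_gain K)^T) *m V^T.
  by rewrite AclE trmx_mul !mulmxA.
apply/matrixP => r c; rewrite /cov_step; move: (lift_gain K *m X *m _) => G.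
rewrite summxE mxE; apply: eq_bigr => q _; rewrite summxE mxE mulr_suml.
apply: eq_bigr => p _; rewrite !mxE.
rewrite (mgetE (v *m v^T) (Ordinal (idxP p r)) (Ordinal (idxP q c))) mxE.
by rewrite big_ord1 mxE mulrA [G p q * _]mulrC.
Qed.

End SecondMoment.

(** * Comparing Euclidean norms, entries and [vech] *)

Section Norms.
Variable R : realType.

Lemma sqr_enorm k (x : 'cV[R]_k) : enorm x ^+ 2 = \sum_i x i 0 ^+ 2.
Proof. by rewrite sqr_sqrtr// sumr_ge0// => i _; rewrite sqr_ge0. Qed.

Lemma enorm_ge0 k (x : 'cV[R]_k) : 0 <= enorm x.
Proof. exact: sqrtr_ge0. Qed.

Lemma sqr_enorm_trace k (x : 'cV[R]_k) : enorm x ^+ 2 = \tr (x *m x^T).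
Proof.
rewrite sqr_enorm; apply: eq_bigr => i _.
by rewrite mxE big_ord1 mxE expr2.
Qed.

Lemma coord_le_enorm k (x : 'cV[R]_k) i : `|x i 0| <= enorm x.
Proof.
rewrite -[leRHS]ger0_norm ?enorm_ge0// -[_ <= _]ler_sqr ?nnegrE// ?normr_ge0//.
rewrite !real_normK ?num_real// sqr_enorm (bigD1 i)//= lerDl.
by rewrite sumr_ge0// => j _; rewrite sqr_ge0.
Qed.

Lemma enorm_le k (x : 'cV[R]_k) c :
  0 <= c -> (forall i, `|x i 0| <= c) -> enorm x <= k%:R * c.
Proof.
move=> c0 xc; rewrite -ler_sqr ?nnegrE ?enorm_ge0 ?mulr_ge0//.
rewrite sqr_enorm (@le_trans _ _ (\sum_(i < k) c ^+ 2))//.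
  apply: ler_sum => i _; rewrite -real_normK ?num_real//.
  by rewrite ler_sqr ?nnegrE.
rewrite sumr_const card_ord exprMn -[leLHS]mulr_natl ler_wpM2r ?sqr_ge0//.
by rewrite -natrX ler_nat; case: (k) => // k'; rewrite leq_pmulr.
Qed.

Lemma enorm_vech_le n (X : 'M[R]_n) c :
  0 <= c -> (forall i j, `|X i j| <= c) -> enorm (vech X) <= (ntri n)%:R * c.
Proof.
move=> c0 Xc; apply: enorm_le => // k; rewrite mxE.
(* Positions past the end of the list and out-of-range indices read 0, which [c] bounds, so neither
   case has to be excluded. *)
set s := flatten _; case: (ltnP k (size s)) => ks; last by rewrite nth_default ?normr0.
have /flattenP[_ /mapP[j _ ->] /mapP[i _ ->]] := mem_nth 0 ks.
by rewrite /mget; case: insub => [i'|]; [case: insub => [j'|]|]; rewrite ?normr0.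
Qed.

Lemma sumn_tri n : sumn [seq (n - c)%N | c <- iota 0 n] = ntri n.
Proof.
(* Doubling avoids the truncated division in [ntri]. *)
suff E : (sumn [seq (n - c) | c <- iota 0 n] * 2 = n * n.+1)%N.
  by rewrite /ntri -E mulnK.
elim: n => //= n IHn; rewrite (iotaDl 1 0) -map_comp.
rewrite (eq_map (g := fun c => (n - c)%N)) => [|c /=]; last by rewrite add1n subSS.
by rewrite subn0 mulnDl IHn; lia.
Qed.

Lemma vech_sym_surj n (y : 'cV[R]_(ntri n)) : exists2 X : 'M[R]_n, X^T = X & vech X = y.
Proof.
pose sh := [seq (n - c)%N | c <- iota 0 n].
(* On and below the diagonal, entry $(a, b)$ lies in column $b$ at offset $a - b$ of the stacked
   list; [minn] and [maxn] reflect this to the upper triangle. *)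
exists (\matrix_(a < n, b < n) mget y (flatten_index sh (minn a b) (maxn a b - minn a b)) 0).
  by apply/matrixP => a b; rewrite !mxE minnC maxnC.
apply/colP => k; rewrite mxE; set X := \matrix_(_, _) _.
rewrite nth_flatten; set ss := [seq [seq _ | _ <- _] | _ <- _].
have shE : shape ss = sh.
  by rewrite /shape -map_comp; apply: eq_map => c /=; rewrite size_map size_iota.
have ksh : (k < sumn sh)%N by rewrite sumn_tri.
have rn : (reshape_index sh k < n)%N.
  by have := reshape_indexP ksh; rewrite size_map size_iota.
have := reshape_offsetP ksh; have := reshape_indexK sh k; rewrite shE.
move: (reshape_index sh k) (reshape_offset sh k) rn => c o cn kE.
rewrite (nth_map 0%N) ?size_iota// nth_iota// add0n => oc.
rewrite /ss (nth_map 0%N) ?size_iota// nth_iota// add0n.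
rewrite (nth_map 0%N) ?size_iota// nth_iota//.
have con : (c + o < n)%N by rewrite -ltn_subRL.
rewrite (mgetE X (Ordinal con) (Ordinal cn)) mxE /=.
rewrite (minn_idPr (leq_addr o c)) (maxn_idPl (leq_addr o c)) addKn kE.
exact: (mgetE y k 0).
Qed.

(** Each entry of [X] is a row of [D] applied to [vech X]. Summing over all rows of [D] gives a
    constant independent of the entry. *)
Lemma entry_le_vech n (D : 'M[R]_(n * n, ntri n)) (X : 'M[R]_n) i j :
  D *m vech X = vec X ->
  `|X i j| <= (\sum_k \sum_l `|D k l|) * enorm (vech X).
Proof.
move=> DX; have ijn : (j * n + i < n * n)%N.
  by rewrite (leq_trans (n := j * n + n)%N) ?ltn_add2l// -mulSnr leq_mul2r ltn_ord orbT.
have -> : X i j = vec X (Ordinal ijn) 0.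
  rewrite vecE /= modnMDl modn_small// divnMDl ?divn_small ?addn0 ?mgetE//.
  exact: leq_ltn_trans (leq0n i) (ltn_ord i).
rewrite -DX mxE (le_trans (ler_norm_sum _ _ _))// (bigD1 (Ordinal ijn))//= mulrDl.
rewrite -[leLHS]addr0 lerD//.
  rewrite mulr_suml; apply: ler_sum => l _.
  by rewrite normrM ler_wpM2l// coord_le_enorm.
rewrite mulr_ge0 ?enorm_ge0// sumr_ge0// => k _.
by rewrite sumr_ge0.
Qed.

End Norms.

(** * Positive semidefinite matrices and polarization *)

Section PositiveSemidefinite.
Variables (R : realType) (n : nat).
Implicit Types P : 'M[R]_n.

Definition psd P := forall y : 'cV[R]_n, 0 <= (y^T *m P *m y) 0 0.

Lemma psd_congr m (A : 'M[R]_(m, n)) P (y : 'cV[R]_m) :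
  psd P -> 0 <= (y^T *m (A *m P *m A^T) *m y) 0 0.
Proof.
by move=> /(_ (A^T *m y)); rewrite trmx_mul trmxK !mulmxA.
Qed.

Lemma psd_rank1 (x : 'cV[R]_n) : psd (x *m x^T).
Proof.
move=> y; have -> : y^T *m (x *m x^T) *m y = (y^T *m x) *m (y^T *m x)^T.
  by rewrite trmx_mul trmxK !mulmxA.
by rewrite mxE big_ord1 [_^T _ _]mxE -expr2 sqr_ge0.
Qed.

(** Testing the form at $e_i \pm e_j$ gives $2|P_{ij}| \le P_{ii} + P_{jj}$, and each diagonal entry
    is at most the trace. *)
Lemma psd_entry_le_trace P i j : P^T = P -> psd P -> `|P i j| <= \tr P.
Proof.
move=> Psym Ppos.
have Pii k : 0 <= P k k.
  by have := Ppos (delta_mx k 0); rewrite trmx_delta -rowE -colE !mxE.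
have Ptr k : P k k <= \tr P by rewrite /mxtrace (bigD1 k)//= lerDl sumr_ge0.
have Pij : P j i = P i j by rewrite -[in LHS]Psym mxE.
have quad s : let y : 'cV[R]_n := delta_mx i 0 + s *: delta_mx j 0 in
    (y^T *m P *m y) 0 0 = P i i + s *+ 2 * P i j + s ^+ 2 * P j j.
  rewrite /=.
  have -> : (delta_mx i 0 + s *: delta_mx j 0)^T
      = delta_mx 0 i + s *: delta_mx 0 j :> 'rV[R]_n.
    by rewrite linearD linearZ /= !trmx_delta.
  rewrite /= !(mulmxDl, mulmxDr) -!scalemxAr -!scalemxAl -!rowE -!colE !mxE Pij; ring.
have := Ppos (delta_mx i 0 + 1 *: delta_mx j 0); rewrite quad.
have := Ppos (delta_mx i 0 + (-1) *: delta_mx j 0); rewrite quad.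
have := Ptr i; have := Ptr j; rewrite ler_norml => *; apply/andP; split; lra.
Qed.

(** The difference of the two rank-one matrices is $2(E_{ij} + E_{ji})$, and $P = (P +
    P^\top)/2$. *)
Lemma sym_polarization P : P^T = P -> P = \sum_i \sum_j (P i j / 4) *:
  ((delta_mx i 0 + delta_mx j 0 : 'cV_n) *m (delta_mx i 0 + delta_mx j 0 : 'cV_n)^T
   - (delta_mx i 0 - delta_mx j 0 : 'cV_n) *m (delta_mx i 0 - delta_mx j 0 : 'cV_n)^T).
Proof.
move=> Psym.
transitivity (\sum_i \sum_j (P i j / 2) *: (delta_mx i j + delta_mx j i)).
  transitivity (2^-1 *: P + 2^-1 *: P^T).
    by rewrite Psym -scalerDl; apply/matrixP => a b; rewrite mxE; field.
  have PT : P^T = \sum_i \sum_j P i j *: delta_mx j i.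
    rewrite {1}(matrix_sum_delta P) linear_sum; apply: eq_bigr => i _ /=.
    rewrite linear_sum; apply: eq_bigr => j _ /=.
    by rewrite linearZ /= trmx_delta.
  rewrite PT {1}(matrix_sum_delta P) !scaler_sumr -big_split /=.
  apply: eq_bigr => i _; rewrite !scaler_sumr -big_split /=.
  by apply: eq_bigr => j _; rewrite -scalerDr -scalerDr scalerA mulrC.
apply: eq_bigr => i _; apply: eq_bigr => j _.
rewrite !linearD !linearN /= !trmx_delta !(mulmxDl, mulmxDr, mulNmx, mulmxN).
rewrite !mul_delta_mx; apply/matrixP => a b; rewrite !mxE; by field.
Qed.

(** The hypothesis on [s] covers both signs. The bound comes from $(a + sb)^2 \le 2a^2 + 2b^2$; the
    value 4 is attained for $i = j$, $s = 1$. *)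
Lemma enorm_delta_pm i j (s : R) : s ^+ 2 = 1 ->
  enorm (delta_mx i 0 + s *: delta_mx j 0 : 'cV[R]_n) ^+ 2 <= 4.
Proof.
move=> s1.
have e1 k : \sum_l (delta_mx k 0 : 'cV[R]_n) l 0 ^+ 2 = 1.
  rewrite (bigD1 k)//= mxE !eqxx big1 ?addr0 ?expr1n// => l /negPf lk.
  by rewrite mxE lk expr0n.
rewrite sqr_enorm (@le_trans _ _ (\sum_l (2 * (delta_mx i 0 : 'cV[R]_n) l 0 ^+ 2
  + 2 * (delta_mx j 0 : 'cV[R]_n) l 0 ^+ 2)))//; last first.
  by rewrite big_split -!mulr_sumr !e1 /=; lra.
apply: ler_sum => l _; rewrite !mxE.
set a := (X in X + _); set b := (X in s * X).
have -> : b ^+ 2 = (s * b) ^+ 2 by rewrite exprMn s1 mul1r.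
by have := sqr_ge0 (a - s * b); nra.
Qed.

End PositiveSemidefinite.

(** * Trajectories of the second-moment recursion *)

Section Trajectories.
Variable R : realType.

Fixpoint cov_traj n m (Mt : nat -> 'M[R]_(n * (n + m))) (K : 'M[R]_(m, n)) (X : 'M[R]_n)
  (t : nat) : 'M[R]_n :=
  if t is t'.+1 then cov_step (Mt t') K (cov_traj Mt K X t') else X.

Variables (n m : nat) (K : 'M[R]_(m, n)).
Implicit Types (Mt : nat -> 'M[R]_(n * (n + m))) (X Y : 'M[R]_n).

(** [cov_traj] recurses on its last step, whereas [msq] integrates out the first one; this
    reconciles the two. *)
Lemma cov_traj_shift Mt X t :
  cov_traj Mt K X t.+1 = cov_traj (fun s => Mt s.+1) K (cov_step (Mt 0%N) K X) t.
Proof. by elim: t => //= t <-. Qed.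

Lemma cov_traj_linear Mt t : linear (fun X => cov_traj Mt K X t).
Proof. by elim: t => //= t IHt a X Y; rewrite IHt cov_step_linear. Qed.

Lemma cov_traj_tr Mt X t :
  (forall s, (Mt s)^T = Mt s) -> X^T = X -> (cov_traj Mt K X t)^T = cov_traj Mt K X t.
Proof. by move=> Msym Xsym; elim: t => //= t IHt; rewrite cov_step_tr Msym IHt. Qed.

(** Makes the additivity and scaling rules available for functions known to be linear only through a
    proof. *)
Lemma linear_funP (U V : lmodType R) (f : U -> V) : linear f ->
  [/\ forall u v, f (u + v) = f u + f v, forall u v, f (u - v) = f u - f v,
      forall a u, f (a *: u) = a *: f u
    & forall (I : finType) (F : I -> U), f (\sum_i F i) = \sum_i f (F i)].
Proof.
move=> hf; pose g : {linear U -> V} := HB.pack f (GRing.isLinear.Build _ _ _ _ f hf).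
split; [exact: (linearD g)|exact: (linearB g)|exact: (linearZZ g)|].
by move=> I F; exact: (linear_sum g).
Qed.

(** Polarization writes [X] with the weights $X_{kl}/4$ on pairs of rank-one matrices. Along each of
    these the entries are bounded by the trace, hence by $4c$; two such terms over 4 leave the
    factor $2c$. *)
Lemma cov_traj_entry_le Mt X t (c : R) :
  (forall s, (Mt s)^T = Mt s) -> X^T = X ->
  (forall x : 'cV[R]_n, psd (cov_traj Mt K (x *m x^T) t)) ->
  (forall x : 'cV[R]_n, \tr (cov_traj Mt K (x *m x^T) t) <= c * enorm x ^+ 2) -> 0 <= c ->
  forall i j, `|cov_traj Mt K X t i j| <= (\sum_k \sum_l `|X k l|) * (2 * c).
Proof.
move=> Msym Xsym Mpsd Mtr c0 i j.
have [_ fB fZ fsum] := linear_funP (cov_traj_linear Mt t).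
rewrite {1}(sym_polarization Xsym) fsum summxE mulr_suml.
rewrite (le_trans (ler_norm_sum _ _ _))//; apply: ler_sum => k _.
rewrite fsum summxE mulr_suml.
rewrite (le_trans (ler_norm_sum _ _ _))//; apply: ler_sum => l _.
rewrite fZ fB mxE normrM [_ / 4]mulrC normrM ger0_norm// -mulrA mulrCA ler_wpM2l//.
rewrite mxE [X in `|_ + X|]mxE.
have bnd (y : 'cV[R]_n) : enorm y ^+ 2 <= 4 -> `|cov_traj Mt K (y *m y^T) t i j| <= c * 4.
  move=> y4; rewrite (le_trans (psd_entry_le_trace _ _ _ (Mpsd y)))//.
    by rewrite cov_traj_tr// trmx_mul trmxK.
  by rewrite (le_trans (Mtr y))// ler_wpM2l.
have b1 := bnd (delta_mx k 0 + delta_mx l 0).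
have {b1}/b1 : enorm (delta_mx k 0 + delta_mx l 0 : 'cV[R]_n) ^+ 2 <= 4.
  by rewrite -[delta_mx l 0]scale1r enorm_delta_pm// expr1n.
have b2 := bnd (delta_mx k 0 - delta_mx l 0).
have {b2}/b2 : enorm (delta_mx k 0 - delta_mx l 0 : 'cV[R]_n) ^+ 2 <= 4.
  by rewrite -scaleN1r enorm_delta_pm// sqrrN expr1n.
have := ler_normB (cov_traj Mt K ((delta_mx k 0 + delta_mx l 0 : 'cV[R]_n)
    *m (delta_mx k 0 + delta_mx l 0 : 'cV[R]_n)^T) t i j)
  (cov_traj Mt K ((delta_mx k 0 - delta_mx l 0 : 'cV[R]_n)
    *m (delta_mx k 0 - delta_mx l 0 : 'cV[R]_n)^T) t i j).
lra.
Qed.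

End Trajectories.

(** On matrix units [g] becomes a finite combination of the products $v_i v_j$, whose integrability
    lets the integral pass through the sums. *)
Lemma integral_rank1 (R : realType) (d : measure_display) (V : measurableType d)
  (mu : probability V R) q (v : V -> 'cV[R]_q) (W : 'M[R]_q) (g : 'M[R]_q -> R) :
  scalar g ->
  (forall i j, mu.-integrable setT (fun w => (v w i 0 * v w j 0)%:E) /\
     (\int[mu]_w (v w i 0 * v w j 0)%:E = (W i j)%:E)%E) ->
  (\int[mu]_w (g (v w *m (v w)^T))%:E = (g W)%:E)%E.
Proof.
move=> hg hW; have [_ _ gZ gsum] := @linear_funP R _ R^o g hg.
have gE (M : 'M[R]_q) : g M = \sum_i \sum_j g (delta_mx i j) * M i j.
  rewrite {1}(matrix_sum_delta M) gsum; apply: eq_bigr => i _.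
  by rewrite gsum; apply: eq_bigr => j _; rewrite gZ mulrC.
have int_ij i j : mu.-integrable setT
    (fun w => ((g (delta_mx i j))%:E * (v w i 0 * v w j 0)%:E)%E).
  by apply: integrableZl => //; exact: (hW i j).1.
transitivity (\int[mu]_w \sum_i \sum_j
    ((g (delta_mx i j))%:E * (v w i 0 * v w j 0)%:E))%E.
  apply: eq_integral => w _; rewrite gE -sumEFin; apply: eq_bigr => i _.
  rewrite -sumEFin; apply: eq_bigr => j _.
  by rewrite mxE big_ord1 [(v w)^T _ _]mxE EFinM.
rewrite integral_sum//; last by move=> i; apply: integrable_sum.
rewrite gE -sumEFin; apply: eq_bigr => i _.
rewrite integral_sum// -sumEFin; apply: eq_bigr => j _.
by rewrite integralZl ?(hW i j).2 ?EFinM//; exact: (hW i j).1.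
Qed.

(** * The closed loop, its expanded system and the two implications *)

Section ClosedLoop.
Variables (R : realType) (n m dth N : nat) (Sth : set 'cV[R]_dth).
Variables (d : measure_display) (V : measurableType d) (vv : V -> 'cV[R]_(n * (n + m))).
Variables (mu : 'cV[R]_dth -> probability V R) (Ms : 'I_N -> 'M[R]_(n * (n + m))).
Hypothesis Ms_sym : forall k, (Ms k)^T = Ms k.
Variable phi : 'cV[R]_dth -> 'cV[R]_N.
Hypothesis SMP : forall th, Sth th -> forall i j,
  (mu th).-integrable setT (fun w => (vv w i 0 * vv w j 0)%:E) /\
  (\int[mu th]_w (vv w i 0 * vv w j 0)%:E
     = (\sum_(k < N) phi th k 0 * Ms k i j)%:E)%E.
Variable K : 'M[R]_(m, n).

(** At [c = phi th] this is the conditional second moment $\mathrm{E}[v v^\top]$. *)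
Definition mixture (c : 'cV[R]_N) := \sum_k c k 0 *: Ms k.

Local Notation M th := (mixture (phi th)).
Implicit Types (th : nat -> 'cV[R]_dth) (X : 'M[R]_n) (x : 'cV[R]_n).

Lemma mixture_sym c : (mixture c)^T = mixture c.
Proof. by rewrite linear_sum; apply: eq_bigr => k _; rewrite linearZ /= Ms_sym. Qed.

Lemma integral_mixture par (g : 'M[R]_(n * (n + m)) -> R) : Sth par -> scalar g ->
  (\int[mu par]_w (g (vv w *m (vv w)^T))%:E = (g (M par))%:E)%E.
Proof.
move=> Sth0 hg; apply: integral_rank1 => // i j.
have [int_ij ->] := SMP Sth0 i j; split=> //; congr EFin.
by rewrite summxE; apply: eq_bigr => k _; rewrite mxE.
Qed.

(** The quadratic form of the step is the integral of the forms of $(A - BK) X (A - BK)^\top$, each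
    of which is nonnegative. *)
Lemma psd_cov_step par X : Sth par -> psd X -> psd (cov_step (M par) K X).
Proof.
move=> Sth0 Xpsd y; rewrite -lee_fin.
rewrite -(integral_mixture (g := fun W => (y^T *m cov_step W K X *m y) 0 0))//; last first.
  by move=> a A B; rewrite cov_step_linearl mulmxDr mulmxDl -scalemxAr -scalemxAl !mxE.
apply: integral_ge0 => w _; rewrite lee_fin cov_step_rank1; exact: psd_congr.
Qed.

Lemma psd_cov_traj th X t : (forall s, Sth (th s)) -> psd X ->
  psd (cov_traj (fun s => M (th s)) K X t).
Proof. by move=> Sth_th Xpsd; elim: t => //= t; apply: psd_cov_step. Qed.

(** Induction on [t] for all starting points: after the first step the inner value is a trace that
    depends linearly on $v v^\top$, so integrating replaces $v v^\top$ by its mean. *)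
Lemma msqE th x t : (forall s, Sth (th s)) ->
  msq vv mu K t th x = (\tr (cov_traj (fun s => M (th s)) K (x *m x^T) t))%:E.
Proof.
elim: t th x => [|t IHt] th x Sth_th /=; first by rewrite sqr_enorm_trace.
rewrite -[cov_step _ _ _]/(cov_traj (fun s => M (th s)) K (x *m x^T) t.+1) cov_traj_shift.
rewrite -(integral_mixture (g := fun W => \tr (cov_traj _ K (cov_step W K (x *m x^T)) t)))//.
  apply: eq_integral => w _; rewrite IHt// cov_step_rank1.
  by rewrite trmx_mul !mulmxA.
move=> a A B; rewrite cov_step_linearl.
by rewrite cov_traj_linear linearD linearZ.
Qed.

Variables (Ee : 'M[R]_(ntri n, n * n)) (D : 'M[R]_(n * n, ntri n)).
Hypothesis HEe : forall X : 'M[R]_n, Ee *m vec X = vech X.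
Hypothesis HD : forall Y : 'M[R]_n, Y^T = Y -> D *m vech Y = vec Y.

Lemma Ftheta_vec c X : Ftheta Ms c K *m vec X = vec (cov_step (mixture c) K X).
Proof.
have [_ _ fZ fsum] := linear_funP (@cov_step_linearl R n m K X).
rewrite fsum linear_sum mulmx_suml; apply: eq_bigr => k _ /=.
by rewrite -scalemxAl FK_vec fZ linearZ.
Qed.

(** The matrix trajectory stays symmetric, so at every step [D] recovers its full [vec] from its
    [vech]. *)
Lemma xtilE (tht : nat -> 'cV[R]_N) X t : X^T = X ->
  xtil Ms Ee D K tht (vech X) t = vech (cov_traj (fun s => mixture (tht s)) K X t).
Proof.
move=> Xsym; elim: t => //= t ->; rewrite /Ccal -!mulmxA HD; last first.
  by rewrite cov_traj_tr// => s; exact: mixture_sym.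
by rewrite Ftheta_vec HEe.
Qed.

Lemma ERMSS_ERS ti beta :
  ERMSS vv mu K ti Sth beta -> ERS Ms Ee D K ti (phi @` Sth) (beta ^+ 2).
Proof.
move=> [/andP[b0 b1] [alpha [a0 stab]]]; split.
  by rewrite exprn_gt0//= expr_lt1// ltW.
pose CD := \sum_k \sum_l `|D k l|.
have CD0 : 0 <= CD by rewrite sumr_ge0// => k _; rewrite sumr_ge0.
(* [ntri n] passes from entries to the norm of [vech], [n * n] times [CD] bounds $\sum |X_{kl}|$ by
   that norm, and $2\alpha^2$ comes from polarization. *)
pose C := (ntri n)%:R * ((n * n)%:R * CD * (2 * alpha ^+ 2)).
have C0 : 0 <= C by rewrite !mulr_ge0// ltW.
(* Adding 1 makes the constant strictly positive. *)
exists (C + 1); split; first by rewrite ltr_wpDl.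
move=> x0 tht [Stht titht] t.
have [X Xsym <-] := vech_sym_surj x0.
(* Parameters are lifted through [phi]. In the time-invariant case a single preimage is repeated, so
   that the lift is constant; otherwise preimages are chosen separately for each time. *)
have [th [Sth_th thE tith]] : exists th : nat -> 'cV[R]_dth,
    [/\ forall s, Sth (th s), forall s, phi (th s) = tht s
      & ti -> forall s, th s = th 0%N].
  case: ti titht {stab} => [/(_ isT) tht0|_].
    by have [par ? parE] := Stht 0%N; exists (fun=> par); split=> // s; rewrite tht0.
  have /choice[th thP] : forall s, exists par, Sth par /\ phi par = tht s.
    by move=> s; have [par ? ?] := Stht s; exists par.
  by exists th; split=> // s; have [] := thP s.
rewrite xtilE//.
have -> : (fun s => mixture (tht s)) = (fun s => M (th s)).
  by apply/funext => s; rewrite thE.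
have c0 : 0 <= alpha ^+ 2 * (beta ^+ 2) ^+ t by rewrite mulr_ge0 ?exprn_ge0// ltW.
have entry i j : `|cov_traj (fun s => M (th s)) K X t i j| <=
    (\sum_k \sum_l `|X k l|) * (2 * (alpha ^+ 2 * (beta ^+ 2) ^+ t)).
  apply: cov_traj_entry_le => //.
  - by move=> s; exact: mixture_sym.
  - by move=> x; apply: psd_cov_traj => //; exact: psd_rank1.
  - move=> x; have := stab x th (conj Sth_th tith) t; rewrite msqE// lee_fin => /le_trans.
    apply; rewrite exprAC le_eqVlt; apply/orP; left; apply/eqP; ring.
rewrite (le_trans (enorm_vech_le _ entry))//.
  by rewrite (mulr_ge0 _ (mulr_ge0 _ c0))// sumr_ge0// => k _; rewrite sumr_ge0.
have Xle : \sum_k \sum_l `|X k l| <= (n * n)%:R * CD * enorm (vech X).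
  rewrite (@le_trans _ _ (\sum_(k < n) \sum_(l < n) (CD * enorm (vech X))))//.
    apply: ler_sum => k _; apply: ler_sum => l _.
    by apply: entry_le_vech; exact: HD.
  by rewrite !sumr_const !card_ord -mulrnA -mulrA mulr_natl.
rewrite (@le_trans _ _ (C * enorm (vech X) * (beta ^+ 2) ^+ t))//; last first.
  by rewrite !ler_wpM2r ?exprn_ge0 ?enorm_ge0 ?lerDl// ltW.
have -> : C * enorm (vech X) * (beta ^+ 2) ^+ t = (ntri n)%:R *
  ((n * n)%:R * CD * enorm (vech X) * (2 * (alpha ^+ 2 * (beta ^+ 2) ^+ t))).
  by rewrite /C; ring.
by rewrite ler_wpM2l// ler_wpM2r// mulr_ge0.
Qed.

Lemma ERS_ERMSS ti beta : 0 < beta < 1 ->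
  ERS Ms Ee D K ti (phi @` Sth) (beta ^+ 2) -> ERMSS vv mu K ti Sth beta.
Proof.
move=> hb [_ [alphat [a0 stab]]]; split => //; have /andP[b0 _] := hb.
pose CD := \sum_k \sum_l `|D k l|.
have CD0 : 0 <= CD by rewrite sumr_ge0// => k _; rewrite sumr_ge0.
(* [n] counts the diagonal entries in the trace, [CD] bounds each by the norm of [vech], and
   [ntri n] comes from bounding [vech (x *m x^T)] by $\|x\|^2$. *)
pose C := n%:R * (CD * (alphat * (ntri n)%:R)).
have C0 : 0 <= C by rewrite !mulr_ge0// ltW.
(* The square root appears because the mean-square bound contains the square of its constant. *)
exists (Num.sqrt (C + 1)); split; first by rewrite sqrtr_gt0 ltr_wpDl.
move=> x th [Sth_th tith] t; rewrite msqE// lee_fin.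
have xxsym : (x *m x^T)^T = x *m x^T by rewrite trmx_mul trmxK.
have adm : admissible ti (phi @` Sth) (fun s => phi (th s)).
  split=> [s|/tith thE s]; [by exists (th s)|by rewrite thE].
have := stab (vech (x *m x^T)) _ adm t; rewrite xtilE//.
set P := cov_traj _ _ _ _ => hP.
have Psym : P^T = P by apply: cov_traj_tr => // s; exact: mixture_sym.
have xx : enorm (vech (x *m x^T)) <= (ntri n)%:R * enorm x ^+ 2.
  apply: enorm_vech_le => [|i j]; first exact: sqr_ge0.
  by rewrite mxE big_ord1 mxE normrM expr2 ler_pM// coord_le_enorm.
rewrite !exprMn sqr_sqrtr; last by rewrite addr_ge0.
rewrite (@le_trans _ _ (n%:R * (CD * enorm (vech P))))//.
  rewrite /mxtrace (@le_trans _ _ (\sum_(i < n) CD * enorm (vech P)))//.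
    apply: ler_sum => i _; rewrite (le_trans (ler_norm _))//.
    by apply: entry_le_vech; exact: HD.
  by rewrite sumr_const card_ord mulr_natl.
rewrite (@le_trans _ _ (C * enorm x ^+ 2 * (beta ^+ t) ^+ 2))//; last first.
  by rewrite !ler_wpM2r ?sqr_ge0 ?lerDl.
have -> : C * enorm x ^+ 2 * (beta ^+ t) ^+ 2 = n%:R * (CD *
   (alphat * ((ntri n)%:R * enorm x ^+ 2) * (beta ^+ 2) ^+ t)).
  by rewrite /C [(beta ^+ 2) ^+ t]exprAC; ring.
rewrite !ler_wpM2l// (le_trans hP)// ler_wpM2r ?exprn_ge0 ?(ltW b0)//.
by rewrite ler_wpM2l// ltW.
Qed.

End ClosedLoop.

Theorem theorem3 (R : realType) (n m dth N : nat)
  (hn : (0 < n)%N) (hm : (0 < m)%N) (hdth : (0 < dth)%N)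
  (Sth : set 'cV[R]_dth)
  (d : measure_display) (V : measurableType d)
  (vv : V -> 'cV[R]_(n * (n + m)))
  (vv_meas : forall i, measurable_fun setT (fun w => vv w i 0))
  (mu : 'cV[R]_dth -> probability V R)
  (Ms : 'I_N -> 'M[R]_(n * (n + m)))
  (Ms_sym : forall k, (Ms k)^T = Ms k)
  (phi : 'cV[R]_dth -> 'cV[R]_N)
  (phi_simplex : forall th, Sth th ->
     (forall k, 0 <= phi th k 0) /\ \sum_(k < N) phi th k 0 = 1)
  (SMP : forall th, Sth th -> forall i j,
     (mu th).-integrable setT (fun w => (vv w i 0 * vv w j 0)%:E) /\
     (\int[mu th]_w (vv w i 0 * vv w j 0)%:E
        = (\sum_(k < N) phi th k 0 * Ms k i j)%:E)%E)
  (Ee : 'M[R]_(ntri n, n * n))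
  (HEe : forall X : 'M[R]_n, Ee *m vec X = vech X)
  (D : 'M[R]_(n * n, ntri n))
  (HD : forall Y : 'M[R]_n, Y^T = Y -> D *m vech Y = vec Y)
  (K : 'M[R]_(m, n)) (ti : bool) (beta : R) (hbeta : 0 < beta < 1) :
  ERMSS vv mu K ti Sth beta <-> ERS Ms Ee D K ti (phi @` Sth) (beta ^+ 2).
Proof.
split; first exact: (ERMSS_ERS Ms_sym SMP HEe HD).
exact: (ERS_ERMSS Ms_sym SMP HEe HD hbeta).
Qed.
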